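(* The trace distance coherence satisfies strong monotonicity for every $2\times 2$ matrix. That is, let $\rho$ be a $2\times 2$ complex matrix and let $\{K_n\}$ be a finite family of incoherent Kraus operators, with $K_n$ of size $d_n\times 2$ ($d_n\ge 1$ arbitrary, possibly depending on $n$) and $\sum_n K_n^\dagger K_n=\mathbb{1}_2$. Then $$\sum_n C_{\mathrm{tr}}(K_n\rho K_n^\dagger)\le C_{\mathrm{tr}}(\rho),$$ where $C_{\mathrm{tr}}$ of a matrix is its trace-norm distance to the diagonal matrices. In particular, if $\rho$ is a qubit state and $C_{\mathrm{tr}}$ of a state is its trace-norm distance to the incoherent states, then with $p_n=\mathrm{Tr}(K_n\rho K_n^\dagger)$ and $\rho_n=K_n\rho K_n^\dagger/p_n$, $$\sum_{n:\,p_n>0} p_n\,C_{\mathrm{tr}}(\rho_n)\le C_{\mathrm{tr}}(\rho).$$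
   Context: Work in $\mathbb{C}^d$ with its fixed standard basis. A state is a positive semidefinite $d\times d$ complex matrix of trace $1$ (a qubit state if $d=2$); an incoherent state is a diagonal state, and $\mathcal{I}$ denotes the set of incoherent states (of the relevant dimension). $\|X\|_1=\mathrm{Tr}\sqrt{X^\dagger X}$ is the trace norm. For a state $\rho$, $C_{\mathrm{tr}}(\rho):=\min_{\delta\in\mathcal{I}}\|\rho-\delta\|_1$. For a general square complex matrix $X$, $C_{\mathrm{tr}}(X):=\min_{D\in\Delta}\|X-D\|_1$, where $\Delta$ is the set of all complex diagonal matrices of the same size. A $d'\times d$ matrix $K$ is an incoherent Kraus operator if $K\delta K^\dagger$ is diagonal for every incoherent state $\delta$ on $\mathbb{C}^d$. $\mathbb{1}_d$ is the $d\times d$ identity. *)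

(* Defs.v *)
From mathcomp Require Import all_boot all_order all_algebra.
From mathcomp Require Import spectral sesquilinear.
From mathcomp Require Import complex.
From mathcomp Require Import boolp classical_sets reals.

Set Implicit Arguments.
Unset Strict Implicit.
Unset Printing Implicit Defensive.

Import Order.TTheory GRing.Theory Num.Theory.
Local Open Scope classical_set_scope.
Local Open Scope ring_scope.
Local Open Scope complex_scope.
Local Open Scope sesquilinear_scope.

Definition is_psd (R : realType) (n : nat) (A : 'M[R[i]]_n) : Prop :=
  A^t* = A /\ forall v : 'cV[R[i]]_n, 0 <= (v^t* *m A *m v) 0 0.

Definition is_state (R : realType) (n : nat) (A : 'M[R[i]]_n) : Prop :=
  is_psd A /\ \tr A = 1.

Definition is_incoherent (R : realType) (n : nat) (A : 'M[R[i]]_n) : Prop :=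
  is_state A /\ is_diag_mx A.

Definition is_incoherent_kraus (R : realType) (m n : nat)
    (K : 'M[R[i]]_(m, n)) : Prop :=
  forall delta : 'M[R[i]]_n,
    is_incoherent delta -> is_diag_mx (K *m delta *m K^t*).

(* The square root by functional calculus along the spectral decomposition
   A = P^-1 *m diag_mx a *m P with P unitary; it is meaningful for normal A,
   and for positive semidefinite A it is the positive square root, see
   [sqrtmxK] and [sqrtmx_psd]. *)
Definition sqrtmx (R : realType) (n : nat) (A : 'M[R[i]]_n) : 'M[R[i]]_n :=
  invmx (spectralmx A) *m diag_mx (map_mx sqrtC (spectral_diag A))
    *m spectralmx A.

(* The trace is a nonnegative real element of R[i], so that no information is
   lost by taking its real part. *)
Definition trnorm (R : realType) (n : nat) (X : 'M[R[i]]_n) : R :=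
  complex.Re (\tr (sqrtmx (X^t* *m X))).

(* In both definitions below the minimum is attained by compactness, so it is
   the infimum.  Both sets are bounded below by 0; the first is never empty,
   and the second is nonempty as soon as 0 < n. *)
Definition Ctr_mx (R : realType) (n : nat) (X : 'M[R[i]]_n) : R :=
  inf [set trnorm (X - D) | D in [set D : 'M[R[i]]_n | is_diag_mx D]].

Definition Ctr_state (R : realType) (n : nat) (rho : 'M[R[i]]_n) : R :=
  inf [set trnorm (rho - delta) |
        delta in [set delta : 'M[R[i]]_n | is_incoherent delta]].

Section SqrtmxPositive.
Context (R : realType) (n : nat) (A : 'M[R[i]]_n) (psdA : is_psd A).

Let normA : A \is normalmx.
Proof. by apply/normalmxP; rewrite psdA.1. Qed.

Let spectralE :
  A = (spectralmx A)^t* *m diag_mx (spectral_diag A) *m spectralmx A.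
Proof.
rewrite -invmx_unitary ?spectral_unitarymx //.
by have /orthomx_spectralP := normA.
Qed.

Lemma spectral_diag_ge0 (i : 'I_n) : 0 <= spectral_diag A 0 i.
Proof.
have UU : spectralmx A *m (spectralmx A)^t* = 1%:M.
  by apply/unitarymxP; exact: spectral_unitarymx.
have := psdA.2 ((spectralmx A)^t* *m delta_mx i 0).
have -> : ((spectralmx A)^t* *m delta_mx i (0 : 'I_1))^t*
   = delta_mx 0 i *m spectralmx A.
  rewrite trmx_mul map_mxM; congr (_ *m _).
    by apply/matrixP=> a b; rewrite !mxE rmorph_nat andbC.
  exact: trmxCK.
rewrite [X in _ *m X *m _]spectralE !mulmxA.
rewrite -(mulmxA (delta_mx 0 i)) UU mulmx1.
rewrite -(mulmxA _ (spectralmx A)) UU mulmx1.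
by rewrite -rowE -colE !mxE eqxx mulr1n.
Qed.

Lemma sqrtmxK : sqrtmx A *m sqrtmx A = A.
Proof.
have uP := spectral_unit A.
rewrite /sqrtmx !mulmxA -(mulmxA _ (spectralmx A)) mulmxV // mulmx1.
rewrite -(mulmxA (invmx _)) mulmx_diag.
have /orthomx_spectralP E := normA.
rewrite [RHS]E; congr (_ *m diag_mx _ *m _).
by apply/rowP=> i; rewrite !mxE -expr2 sqrtCK.
Qed.

Lemma sqrtmx_psd : is_psd (sqrtmx A).
Proof.
rewrite /sqrtmx invmx_unitary ?spectral_unitarymx //.
set P := spectralmx A; set d := map_mx sqrtC _.
have d0 i : 0 <= d 0 i by rewrite mxE sqrtC_ge0 spectral_diag_ge0.
split.
  rewrite !trmx_mul !map_mxM trmxCK mulmxA; congr (_ *m _ *m _).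
  apply/matrixP=> i j; rewrite !mxE eq_sym; case: eqP => [->|_] /=.
    by rewrite !mulr1n geC0_conj // sqrtC_ge0 spectral_diag_ge0.
  by rewrite !mulr0n rmorph0.
move=> v; rewrite !mulmxA -[_ *m P *m v]mulmxA.
have -> : v^t* *m P^t* = (P *m v)^t* by rewrite trmx_mul map_mxM.
move: (P *m v) => w.
rewrite mxE sumr_ge0 // => i _; rewrite mul_mx_diag mxE mulrAC.
by rewrite mulr_ge0 // 2!mxE mulrC mul_conjC_ge0.
Qed.

End SqrtmxPositive.

(* Main.v *)
(* An incoherent Kraus operator K has at most one nonzero entry in each column.
   Hence, if rho is 2 x 2, the off-diagonal part of K rho K^* has at most two
   nonzero entries, in symmetric positions, and its trace norm is at most
   |alpha beta| (|rho_01| + |rho_10|), where alpha and beta are the nonzero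
   entries of K; by AM-GM, |alpha beta| <= Tr(K^* K) / 2, and these numbers sum
   to 1.  On the other hand every 2 x 2 matrix X satisfies
   |X|_1^2 = |X|_2^2 + 2 |det X| >= (|X_01| + |X_10|)^2, so that
   |rho_01| + |rho_10| bounds C_tr(rho) from below. *)
Require Import Defs.
From mathcomp Require Import all_boot all_order all_algebra.
From mathcomp Require Import spectral sesquilinear complex reals.
From mathcomp Require Import ring.

Set Implicit Arguments.
Unset Strict Implicit.
Unset Printing Implicit Defensive.

Import Order.TTheory GRing.Theory Num.Theory.

Local Open Scope ring_scope.
Local Open Scope complex_scope.
Local Open Scope sesquilinear_scope.

(** * Diagonal parts and identities for 2 x 2 matrices *)

(** Serves as the competitor in both minima: it bounds the coherence from above by the trace norm of
    the off-diagonal part. *)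
Definition diag_part (V : nmodType) (n : nat) (M : 'M[V]_n) : 'M[V]_n :=
  diag_mx (\row_i M i i).

Lemma diag_part_is_diag (V : nmodType) (n : nat) (M : 'M[V]_n) :
  is_diag_mx (diag_part M).
Proof. exact: diag_mx_is_diag. Qed.

Lemma sub_diag_partE (V : zmodType) (n : nat) (M : 'M[V]_n) i j :
  (M - diag_part M) i j = M i j *+ (i != j).
Proof.
by rewrite !mxE; have [<-|] := eqVneq i j; rewrite ?subrr ?mulr0n ?subr0.
Qed.

Lemma sum_ord2 (V : nmodType) (F : 'I_2 -> V) : \sum_i F i = F 0 + F 1.
Proof. by rewrite big_ord_recl big_ord1; congr (F _ + F _); apply/val_inj. Qed.

Lemma det_mx22 (A : comPzRingType) (M : 'M[A]_2) :
  \det M = M 0 0 * M 1 1 - M 0 1 * M 1 0.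
Proof.
rewrite (expand_det_row _ 0) sum_ord2 /cofactor !det_mx11 !mxE /=.
rewrite expr0 expr1 mul1r mulN1r mulrN.
by congr (M _ _ * M _ _ - M _ _ * M _ _); apply/val_inj.
Qed.

(** In terms of eigenvalues, (a + b)^2 = a^2 + b^2 + 2ab. Applied to the square root of X^* X, it
    gives the square of the trace norm of X without computing singular values. *)
Lemma sqr_mxtrace22 (A : comPzRingType) (M : 'M[A]_2) :
  \tr M ^+ 2 = \tr (M *m M) + 2 * \det M.
Proof. by rewrite det_mx22 /mxtrace !sum_ord2 !mxE !sum_ord2; ring. Qed.

Section TraceNorm.
Context {R : realType}.
Local Notation C := R[i].

(** * Adjoints and positive semidefinite matrices *)

Lemma adjmx_mul m n p (A : 'M[C]_(m, n)) (B : 'M[C]_(n, p)) :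
  (A *m B)^t* = B^t* *m A^t*.
Proof. by rewrite trmx_mul map_mxM. Qed.

Lemma adjmxE m n (A : 'M[C]_(m, n)) i j : A^t* i j = (A j i)^*%R.
Proof. by rewrite !mxE. Qed.

Lemma sqnorm_mxE m (v : 'cV[C]_m) :
  (v^t* *m v) 0 0 = \sum_i `|v i 0| ^+ 2.
Proof. by rewrite mxE; apply: eq_bigr => i _; rewrite adjmxE mulrC -normCK. Qed.

Lemma sqnorm_mx_eq0 m (v : 'cV[C]_m) : (v^t* *m v) 0 0 <= 0 -> v = 0.
Proof.
rewrite sqnorm_mxE => v0; apply/colP => i; rewrite mxE; apply/eqP.
have /eqP : \sum_i `|v i 0| ^+ 2 = 0.
  by apply/le_anti; rewrite v0 sumr_ge0 // => k _; rewrite exprn_ge0.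
rewrite psumr_eq0 => [/allP/(_ i)|k _]; last by rewrite exprn_ge0.
by rewrite mem_index_enum sqrf_eq0 normr_eq0 => /(_ isT).
Qed.

Lemma psd_conj m n (K : 'M[C]_(m, n)) (A : 'M[C]_n) :
  is_psd A -> is_psd (K *m A *m K^t*).
Proof.
case=> hA pA; split; first by rewrite !adjmx_mul hA trmxCK mulmxA.
by move=> v; have := pA (K^t* *m v); rewrite adjmx_mul trmxCK !mulmxA.
Qed.

Lemma psd_scale n (a : C) (A : 'M[C]_n) :
  0 <= a -> is_psd A -> is_psd (a *: A).
Proof.
move=> a0 [hA pA]; split.
  apply/matrixP=> i j; rewrite -[in RHS]hA !mxE rmorphM.
  by congr (_ * _); exact: geC0_conj.
by move=> v; rewrite -scalemxAr -scalemxAl mxE mulr_ge0.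
Qed.

Lemma psd_gram m n (X : 'M[C]_(m, n)) : is_psd (X^t* *m X).
Proof.
split; first by rewrite adjmx_mul trmxCK.
move=> v; rewrite mulmxA -adjmx_mul -mulmxA sqnorm_mxE.
by rewrite sumr_ge0 // => i _; rewrite exprn_ge0.
Qed.

Lemma psd_diag_ge0 n (A : 'M[C]_n) i : is_psd A -> 0 <= A i i.
Proof.
case=> _ /(_ (delta_mx i 0)).
suff -> : (delta_mx i (0 : 'I_1))^t* = delta_mx 0 i :> 'M[C]_(1, n).
  by rewrite -rowE -colE !mxE.
by apply/matrixP=> a b; rewrite !mxE rmorph_nat andbC.
Qed.

Lemma psd_trace_ge0 n (A : 'M[C]_n) : is_psd A -> 0 <= \tr A.
Proof. by move=> pA; rewrite sumr_ge0 // => i _; exact: psd_diag_ge0. Qed.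

Lemma psd_diag_mx n (t : 'rV[C]_n) :
  (forall i, 0 <= t 0 i) -> is_psd (diag_mx t).
Proof.
move=> t0; split.
  apply/matrixP=> i j; rewrite !mxE eq_sym; case: eqP => [->|_] /=.
    by rewrite !mulr1n geC0_conj.
  by rewrite !mulr0n rmorph0.
move=> v; rewrite mxE sumr_ge0 // => i _; rewrite mul_mx_diag mxE mulrAC.
by rewrite mulr_ge0 // adjmxE mulrC mul_conjC_ge0.
Qed.

(** Makes [diag_part] admissible in the minimum over incoherent states too, so that one upper bound
    serves both measures. *)
Lemma incoherent_diag_part n (A : 'M[C]_n) :
  is_state A -> is_incoherent (diag_part A).
Proof.
move=> [pA trA]; split; last exact: diag_part_is_diag.
split; first by apply: psd_diag_mx => i; rewrite mxE psd_diag_ge0.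
by rewrite mxtrace_diag -[RHS]trA; apply: eq_bigr => i _; rewrite mxE.
Qed.

(** These basis states are the test inputs that reveal the shape of an incoherent Kraus operator. *)
Lemma incoherent_delta n (l : 'I_n) : is_incoherent (delta_mx l l : 'M[C]_n).
Proof.
have -> : delta_mx l l = diag_mx (delta_mx 0 l) :> 'M[C]_n.
  apply/matrixP=> i j; rewrite !mxE eqxx -mulrnA mulnb /=.
  by congr _%:R; have [->|] := eqVneq i l; rewrite // eq_sym.
split; last exact: diag_mx_is_diag.
split; first by apply: psd_diag_mx => i; rewrite mxE ler0n.
rewrite mxtrace_diag (bigD1 l) //= mxE !eqxx big1 ?addr0 // => i.
by rewrite mxE eqxx => /negbTE ->.
Qed.

(* A column w of S - diag t satisfies S w = - t_i w, which positivity of S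
   allows only if w = 0. *)
Lemma psd_sqrt_diag_uniq n (S : 'M[C]_n) (t : 'rV[C]_n) :
  is_psd S -> (forall i, 0 <= t 0 i) ->
  S *m S = diag_mx (\row_i t 0 i ^+ 2) -> S = diag_mx t.
Proof.
move=> [hS pS] t0 SS.
apply/matrixP => k i; pose e : 'cV[C]_n := delta_mx i 0.
have De (s : 'rV[C]_n) : diag_mx s *m e = s 0 i *: e.
  apply/colP => j; rewrite mul_diag_mx !mxE.
  by case: eqP => [->|]; rewrite ?mulr0.
pose w := S *m e - t 0 i *: e.
suff w0 : w = 0.
  have /colP/(_ k) : S *m e = diag_mx t *m e by apply/eqP; rewrite De -subr_eq0 -/w w0.
  by rewrite -!colE !mxE.
have Sw : S *m w = - t 0 i *: w.
  rewrite mulmxBr mulmxA SS De -scalemxAr mxE /w scalerBr scalerA scaleNr.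
  by rewrite mulNr scaleNr opprK addrC expr2.
(* If t_i = 0, then w = S e and w^* w = e^* S w = 0. If t_i > 0, positivity of w^* S w = - t_i w^* w
   forces w^* w <= 0. *)
have := t0 i; rewrite le0r => /orP[/eqP ti0|ti0]; apply: sqnorm_mx_eq0.
  have wE : w = S *m e by rewrite /w ti0 scale0r subr0.
  by rewrite {1}wE adjmx_mul hS -mulmxA Sw ti0 oppr0 scale0r mulmx0 mxE.
have := pS w; rewrite -mulmxA Sw -scalemxAr mxE mulNr oppr_ge0.
by rewrite pmulr_rle0.
Qed.

(** * The trace norm: explicit values and a lower bound *)

Lemma trnormE n (X : 'M[C]_n) : (trnorm X)%:C = \tr (sqrtmx (X^t* *m X)).
Proof.
have := psd_trace_ge0 (sqrtmx_psd (psd_gram X)).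
by move=> /ger0_real; rewrite /trnorm => /complex_realP[x ->].
Qed.

Lemma trnorm_ge0 n (X : 'M[C]_n) : 0 <= trnorm X.
Proof.
rewrite -lecR trnormE; exact: psd_trace_ge0 (sqrtmx_psd (psd_gram X)).
Qed.

(** [diag_mx t] is a positive square root of the Gram matrix, so by uniqueness it is the one that
    [sqrtmx] builds from an unspecified eigenbasis. *)
Lemma trnorm_gram_diag n (X : 'M[C]_n) (t : 'rV[C]_n) :
  (forall i, 0 <= t 0 i) ->
  X^t* *m X = diag_mx (\row_i t 0 i ^+ 2) -> (trnorm X)%:C = \sum_i t 0 i.
Proof.
move=> t0 XX; rewrite trnormE -mxtrace_diag; congr (\tr _).
apply: psd_sqrt_diag_uniq => //; first exact: sqrtmx_psd (psd_gram X).
by rewrite sqrtmxK //; exact: psd_gram.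
Qed.

Lemma trnorm0 n : trnorm (0 : 'M[C]_n) = 0.
Proof.
apply: complexI; rewrite (@trnorm_gram_diag _ _ 0).
- by rewrite big1 // => i _; rewrite mxE.
- by move=> i; rewrite mxE.
- rewrite mulmx0; apply/matrixP => i j.
  by rewrite !mxE expr0n /= mul0rn.
Qed.

(** Since i and j differ, the cross terms of the Gram matrix vanish. It is diagonal, with |u|^2 at j
    and |v|^2 at i. *)
Lemma trnorm_two_entries n (i j : 'I_n) (u v : C) : i != j ->
  (trnorm (u *: delta_mx i j + v *: delta_mx j i))%:C = `|u| + `|v|.
Proof.
move=> ij; pose t : 'rV[C]_n := `|u| *: delta_mx 0 j + `|v| *: delta_mx 0 i.
have sumd (x : 'I_n) : \sum_k (delta_mx 0 x : 'rV[C]_n) 0 k = 1.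
  rewrite (bigD1 x) //= mxE !eqxx big1 ?addr0 // => k.
  by rewrite mxE eqxx => /negbTE ->.
rewrite (@trnorm_gram_diag _ _ t).
- under eq_bigr do rewrite /t mxE [X in X + _]mxE [X in _ + X]mxE.
  by rewrite big_split -!mulr_sumr !sumd !mulr1.
- by move=> k; rewrite !mxE addr_ge0 // mulr_ge0 ?ler0n.
- have adjd (x : C) a b :
    (x *: delta_mx a b : 'M[C]_n)^t* = x^*%R *: delta_mx b a.
    by apply/matrixP=> k l; rewrite !mxE rmorphM rmorph_nat andbC.
  have adjD (A B : 'M[C]_n) : (A + B)^t* = A^t* + B^t*.
    by apply/matrixP=> k l; rewrite !mxE rmorphD.
  rewrite adjD !adjd mulmxDl !mulmxDr.
  rewrite -!scalemxAl -!scalemxAr !mul_delta_mx !mul_delta_mx_0 //; last first.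
    by rewrite eq_sym.
  rewrite !scaler0 addr0 add0r !scalerA ![_^*%R * _]mulrC -!normCK.
  apply/matrixP=> k l; rewrite !mxE.
  have [<-|kl] := eqVneq k l; last first.
    have kF x : (k == x) && (l == x) = false.
      by apply/negP => /andP[/eqP kx /eqP lx]; rewrite kx lx eqxx in kl.
    by rewrite !kF !mulr0 addr0.
  rewrite !andbb /= mulr1n; have [->|_] := eqVneq k j.
    by rewrite eq_sym (negbTE ij) /= !mulr1 !mulr0 !addr0.
  rewrite !mulr0 !add0r.
  by case: (k == i); rewrite ?mulr1 // !mulr0 expr0n.
Qed.

Lemma offdiag_le_trnorm (X : 'M[C]_2) :
  `|X 0 1| + `|X 1 0| <= (trnorm X)%:C.
Proof.
set A := X^t* *m X.
have pA : is_psd A := psd_gram X.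
set S := sqrtmx A.
pose s i := sqrtC (spectral_diag A 0 i).
have s0 i : 0 <= s i by rewrite sqrtC_ge0 spectral_diag_ge0.
have trS : \tr S = s 0 + s 1.
  rewrite /S /sqrtmx mxtrace_mulC mulmxA mulmxV ?spectral_unit // mul1mx.
  by rewrite mxtrace_diag sum_ord2 !mxE.
have detS : \det S = s 0 * s 1.
  rewrite /S /sqrtmx !det_mulmx mulrAC -det_mulmx mulVmx ?spectral_unit //.
  rewrite det1 mul1r det_diag big_ord_recl big_ord1 !mxE.
  by congr (s _ * s _); apply/val_inj.
have SS : S *m S = A by exact: sqrtmxK.
have detA : \det A = `|\det X| ^+ 2.
  by rewrite det_mulmx det_map_mx det_tr normCK mulrC.
(* Both sides are nonnegative and have the same square, [\det A]. *)
have dS : \det S = `|\det X|.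
  apply/eqP; rewrite -(eqrXn2 (n := 2)) //; last by rewrite detS mulr_ge0.
  by apply/eqP; rewrite -detA -SS (det_mulmx S) expr2.
have trS2 : \tr S ^+ 2 = \tr A + 2 * `|\det X|.
  by rewrite sqr_mxtrace22 SS dS.
have trA : \tr A = `|X 0 0| ^+ 2 + `|X 0 1| ^+ 2 + `|X 1 0| ^+ 2 + `|X 1 1| ^+ 2.
  by rewrite /mxtrace sum_ord2 !mxE !sum_ord2 !adjmxE !normCK; ring.
rewrite trnormE -/A -/S -(ler_pXn2r (n := 2)) ?nnegrE ?addr_ge0 //; last first.
  by rewrite trS addr_ge0.
rewrite trS2 trA det_mx22.
(* Triangle inequality for X_01 X_10 = X_00 X_11 - det X. *)
have tri : `|X 0 1| * `|X 1 0| <=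
    `|X 0 0 * X 1 1 - X 0 1 * X 1 0| + `|X 0 0| * `|X 1 1|.
  rewrite -!normrM -[X in X <= _]normrN.
  have := ler_normB (X 0 0 * X 1 1 - X 0 1 * X 1 0) (X 0 0 * X 1 1).
  by rewrite addrAC subrr add0r.
have sq : 0 <= (`|X 0 0| - `|X 1 1|) ^+ 2 by rewrite -realEsqr realB.
rewrite -subr_ge0.
set e := `|_ - _| in tri *.
(* The difference of the squares is a perfect square plus twice the slack in [tri]. *)
rewrite (_ : _ - _ = (`|X 0 0| - `|X 1 1|) ^+ 2 +
  2 * (e + `|X 0 0| * `|X 1 1| - `|X 0 1| * `|X 1 0|)); last by ring.
by rewrite addr_ge0 // mulr_ge0 // subr_ge0.
Qed.

(** * Bounds on the two coherence measures *)

Lemma Ctr_mx_le n (X D : 'M[C]_n) : is_diag_mx D -> Ctr_mx X <= trnorm (X - D).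
Proof.
move=> dD; apply: ge_inf; last by exists D.
by exists 0 => _ [E _ <-]; exact: trnorm_ge0.
Qed.

Lemma Ctr_state_le n (X D : 'M[C]_n) :
  is_incoherent D -> Ctr_state X <= trnorm (X - D).
Proof.
move=> dD; apply: ge_inf; last by exists D.
by exists 0 => _ [E _ <-]; exact: trnorm_ge0.
Qed.

(** Subtracting D leaves the off-diagonal entries unchanged, so the bound is uniform in D and passes
    to both infima. *)
Lemma offdiag_le_trnorm_diag (X D : 'M[C]_2) : is_diag_mx D ->
  complex.Re (`|X 0 1| + `|X 1 0|) <= trnorm (X - D).
Proof.
move=> /is_diag_mxP dD; rewrite -lecR RRe_real; last first.
  by rewrite ger0_real ?addr_ge0.
have := offdiag_le_trnorm (X - D).
by rewrite !mxE (dD 0 1) // (dD 1 0) // !oppr0 !addr0.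
Qed.

Lemma offdiag_le_Ctr_mx (X : 'M[C]_2) :
  complex.Re (`|X 0 1| + `|X 1 0|) <= Ctr_mx X.
Proof.
apply: lb_le_inf.
  by exists (trnorm (X - diag_part X)), (diag_part X) => //; exact: diag_part_is_diag.
by move=> _ [D dD <-]; exact: offdiag_le_trnorm_diag.
Qed.

Lemma offdiag_le_Ctr_state (X : 'M[C]_2) :
  complex.Re (`|X 0 1| + `|X 1 0|) <= Ctr_state X.
Proof.
apply: lb_le_inf.
  by exists (trnorm (X - delta_mx 0 0)), (delta_mx 0 0) => //; exact: incoherent_delta.
by move=> _ [D [_ dD] <-]; exact: offdiag_le_trnorm_diag.
Qed.

(** * Incoherent Kraus operators *)

(** The image of the l-th basis state has (k, i) entry K_kl times the conjugate of K_il. If K_il is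
    nonzero, diagonality kills every other K_kl. *)
Lemma incoherent_kraus_col m n (K : 'M[C]_(m, n)) :
  (0 < m)%N -> is_incoherent_kraus K ->
  forall l, exists i, forall k, k != i -> K k l = 0.
Proof.
case: m K => // m K _ hK l.
have [/existsP[i Ki]|/existsPn K0] := boolP [exists i, K i l != 0]; last first.
  (* The column is zero, so any row will do; row 0 exists because m is positive. *)
  by exists 0 => k _; apply/eqP/negPn/K0.
exists i => k ki; have /is_diag_mxP/(_ k i ki) := hK _ (incoherent_delta l).
have -> : (K *m delta_mx l l *m K^t*) k i = K k l * (K i l)^*%R.
  rewrite mxE (bigD1 l) //= big1 ?addr0 => [|j jl].
    rewrite adjmxE; congr (_ * _).
    rewrite mxE (bigD1 l) //= big1 ?addr0 => [|j jl].
      by rewrite mxE !eqxx mulr1.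
    by rewrite mxE (negbTE jl) mulr0.
  rewrite mxE big1 ?mul0r // => j' _.
  by rewrite mxE (negbTE jl) andbF mulr0.
by move/eqP; rewrite mulf_eq0 conjC_eq0 (negbTE Ki) orbF => /eqP.
Qed.

(** The estimate for a single operator; its weight, half the trace of K^* K, is chosen to sum to 1
    over the family. *)
Lemma trnorm_kraus_offdiag m (K : 'M[C]_(m, 2)) (rho : 'M[C]_2) :
  (0 < m)%N -> is_incoherent_kraus K ->
  (trnorm (K *m rho *m K^t* - diag_part (K *m rho *m K^t*)))%:C <=
  (`|rho 0 1| + `|rho 1 0|) * (\tr (K^t* *m K) / 2).
Proof.
move=> m0 hK.
have [i Ki] := incoherent_kraus_col m0 hK 0.
have [j Kj] := incoherent_kraus_col m0 hK 1.
pose al := K i 0; pose be := K j 1.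
have K0E k : K k 0 = al *+ (k == i).
  by have [->|/Ki] := eqVneq k i.
have K1E k : K k 1 = be *+ (k == j).
  by have [->|/Kj] := eqVneq k j.
set M := K *m rho *m K^t*.
have ME k l : M k l =
    (al * rho 0 0 * al^*%R) *+ ((k == i) && (l == i))
    + (be * rho 1 0 * al^*%R) *+ ((k == j) && (l == i))
    + (al * rho 0 1 * be^*%R) *+ ((k == i) && (l == j))
    + (be * rho 1 1 * be^*%R) *+ ((k == j) && (l == j)).
  rewrite !mxE !sum_ord2 !mxE !sum_ord2 !K0E !K1E !rmorphMn /=.
  case: (k == i); case: (k == j); case: (l == i); case: (l == j) => /=;
    rewrite ?mulr1n ?mulr0n; ring.
move: M ME => M ME.
have neqF k l x : k != l -> (k == x) && (l == x) = false.
  by move=> kl; apply/negP => /andP[/eqP kx /eqP lx]; rewrite kx lx eqxx in kl.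
have q0 : 0 <= \tr (K^t* *m K) / 2.
  by rewrite divr_ge0 // psd_trace_ge0 //; exact: psd_gram.
(* If both columns are supported in the same row, K rho K^* has at most one nonzero entry, on the
   diagonal. *)
have [ij|ij] := eqVneq i j.
  have -> : M - diag_part M = 0.
    apply/matrixP => k l; rewrite sub_diag_partE mxE.
    have [//|kl] := eqVneq k l.
    by rewrite ME ij !neqF // !mulr0n !addr0.
  by rewrite trnorm0 mulr_ge0 // addr_ge0.
have -> : M - diag_part M =
  (al * rho 0 1 * be^*%R) *: delta_mx i j + (be * rho 1 0 * al^*%R) *: delta_mx j i.
  apply/matrixP => k l; rewrite sub_diag_partE !mxE !mulr_natr.
  have [<-|kl] := eqVneq k l; last first.
    by rewrite ME !neqF // !mulr0n add0r addr0 mulr1n addrC.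
  have kF : (k == i) && (k == j) = false.
    by apply/negP => /andP[/eqP ki /eqP kj]; rewrite -ki -kj eqxx in ij.
  by rewrite [_ && (k == i)]andbC kF !mulr0n addr0.
rewrite trnorm_two_entries // !normrM !norm_conjC.
have -> : \tr (K^t* *m K) = `|al| ^+ 2 + `|be| ^+ 2.
  have gramE l : (K^t* *m K) l l = \sum_k `|K k l| ^+ 2.
    by rewrite mxE; apply: eq_bigr => k _; rewrite adjmxE mulrC -normCK.
  rewrite /mxtrace sum_ord2 !gramE (bigD1 i) //= [X in _ + X](bigD1 j) //=.
  rewrite !big1 ?addr0 // => k.
    by move=> /Kj ->; rewrite normr0 expr0n.
  by move=> /Ki ->; rewrite normr0 expr0n.
have sq : 0 <= (`|al| - `|be|) ^+ 2 by rewrite -realEsqr realB.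
(* AM-GM: the slack is a multiple of (|alpha| - |beta|)^2 / 2. *)
rewrite -subr_ge0 (_ : _ - _ =
  (`|rho 0 1| + `|rho 1 0|) * ((`|al| - `|be|) ^+ 2 / 2)); last by field.
by rewrite mulr_ge0 ?addr_ge0 // divr_ge0.
Qed.

End TraceNorm.

(** * Strong monotonicity: summation over the Kraus family *)

Theorem corollary3 (R : realType) (I : finType) (d : I -> nat)
    (K : forall n : I, 'M[R[i]]_(d n, 2))
    (hd : forall n : I, (0 < d n)%N)
    (hK : forall n : I, is_incoherent_kraus (K n))
    (hsum : \sum_(n : I) (K n)^t* *m K n = 1%:M)
    (rho : 'M[R[i]]_2) :
  \sum_(n : I) Ctr_mx (K n *m rho *m (K n)^t*) <= Ctr_mx rho
  /\
  (is_state rho ->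
   let p := fun n : I => complex.Re (\tr (K n *m rho *m (K n)^t*)) in
   let rho_ := fun n : I => (p n)^-1%:C *: (K n *m rho *m (K n)^t*) in
   \sum_(n : I | 0 < p n) p n * Ctr_state (rho_ n) <= Ctr_state rho).
Proof.
set c := `|rho 0 1| + `|rho 1 0|.
have c0 : 0 <= c by rewrite addr_ge0.
pose q n := \tr ((K n)^t* *m K n) / 2.
have q0 n : 0 <= q n by rewrite divr_ge0 // psd_trace_ge0 //; exact: psd_gram.
have cq0 n : 0 <= c * q n by exact: mulr_ge0.
(* The trace of the 2 x 2 identity is 2, which the halves in [q] normalize. *)
have sum_q : \sum_n q n = 1.
  have := congr1 mxtrace hsum.
  by rewrite raddf_sum mxtrace1 -mulr_suml => ->; rewrite divff ?pnatr_eq0.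
have sum_cq : \sum_n complex.Re (c * q n) = complex.Re c.
  by rewrite -raddf_sum -mulr_sumr sum_q mulr1.
have ReK (x : R[i]) : 0 <= x -> (complex.Re x)%:C = x.
  by move=> x0; rewrite RRe_real // ger0_real.
split.
  apply: le_trans (offdiag_le_Ctr_mx rho); rewrite -/c -sum_cq.
  apply: ler_sum => n _.
  apply: le_trans (Ctr_mx_le _ (diag_part_is_diag (K n *m rho *m (K n)^t*))) _.
  rewrite -lecR [leRHS](ReK _ (cq0 n)); exact: trnorm_kraus_offdiag.
move=> [prho _].
pose p n := complex.Re (\tr (K n *m rho *m (K n)^t*)).
pose rho_ n := (p n)^-1%:C *: (K n *m rho *m (K n)^t*).
change (\sum_(n | 0 < p n) p n * Ctr_state (rho_ n) <= Ctr_state rho).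
apply: le_trans (offdiag_le_Ctr_state rho); rewrite -/c -sum_cq.
(* The outcomes outside 0 < p_n contribute nonnegative terms [c * q n] on the right and are
   dropped. *)
rewrite [leRHS](bigID (fun n => 0 < p n)) /= -[leLHS]addr0 lerD //; last first.
  by rewrite sumr_ge0 // => n _; rewrite -lecR (ReK _ (cq0 n)).
apply: ler_sum => n pn.
have pM : is_psd (K n *m rho *m (K n)^t*) by exact: psd_conj.
have st : is_state (rho_ n).
  split; first by apply: psd_scale => //; rewrite lecR invr_ge0 ltW.
  rewrite mxtraceZ -(ReK _ (psd_trace_ge0 pM)) -/(p n) -rmorphM mulVf //.
  by rewrite gt_eqF.
apply: (@le_trans _ _ (p n * trnorm (rho_ n - diag_part (rho_ n)))).
  rewrite ler_pM2l //; apply: Ctr_state_le; exact: incoherent_diag_part.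
rewrite -ler_pdivlMl // -lecR rmorphM /= (ReK _ (cq0 n)).
(* Moving 1/p_n onto rho lets the single-operator estimate apply to the rescaled input; the factor
   then matches the 1/p_n obtained by dividing by p_n. *)
have -> : rho_ n = K n *m ((p n)^-1%:C *: rho) *m (K n)^t*.
  by rewrite -scalemxAr -scalemxAl.
apply: le_trans (trnorm_kraus_offdiag _ _ (hK n)) _ => //.
rewrite !mxE !normrM ger0_norm ?lecR ?invr_ge0 ?(ltW pn) //.
by rewrite -mulrDr -mulrA.
Qed.
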